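(* Let $p(x)$ and $q(x)$ be non-zero polynomials and let $g(x)=\sum_{n\ge0}g_nx^n$ be a power series which is the expansion of $$g(x)=\sqrt{q(x)/p(x)}.$$ Define the polynomials $$R=2qp=\sum_{n=0}^{\deg R}R_nx^n,\qquad Q=qp'-q'p=\sum_{n=0}^{\deg Q}Q_nx^n,$$ and set $R_n=0$ and $Q_n=0$ whenever $n<0$ or $n$ exceeds the respective degree. Then $g$ obeys the differential equation $$R\,g'+Q\,g=0,$$ and consequently $$\sum_{j=0}^{\deg R}\bigl[(n-j)R_j+Q_{j-1}\bigr]g_{n-j}=0\qquad\text{for all integers } n>\deg R .$$
   Context: Polynomials have complex coefficients; primes denote $d/dx$. The statement that the power series $g(x)=\sum_{n\ge0}g_nx^n$ is the expansion of the given expression means: $g$ has a positive radius of convergence, and on some non-empty open connected subset of its disc of convergence $g$ equals the given expression for some choice of analytic branch of the square root (the expression being well defined there). *)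

(* Defs.v *)
From HB Require Import structures.
From mathcomp Require Import all_boot all_order all_algebra.
From mathcomp Require Import all_classical all_reals all_analysis.
From mathcomp Require Import complex.

Set Implicit Arguments.
Unset Strict Implicit.
Unset Printing Implicit Defensive.

Import Order.TTheory GRing.Theory Num.Theory.
Import numFieldNormedType.Exports.

Local Open Scope classical_set_scope.
Local Open Scope ring_scope.

(* R[i] does not inherit the norm topology directly; MathComp-Analysis puts it
   on the carrier of any numFieldType, hence this packed alias. In particular
   `derivable f x 1` and `derive1 f x` on Cplx R are complex differentiability
   and the complex derivative. *)
Definition Cplx (R : realType) : numClosedFieldType := R[i].

Section PowerSeries.
Context {R : realType}.
Local Notation C := (Cplx R).
Implicit Types (a : nat -> C) (x : C) (U : set C) (f s : C -> C).

(* The library's pseries is restricted to a realType. *)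
Definition cpseries a x : nat -> C := [series a n * x ^+ n]_n.

Definition psum a x : C := limn (cpseries a x).

(* `|x| lives in the complex field itself, whence the real part. *)
Definition modulus x : R := complex.Re `|x|.

Definition cvg_radius a : \bar R :=
  ereal_sup [set (modulus x)%:E | x in [set x | cvgn (cpseries a x)]].

Definition cvg_disc a : set C := [set x | ((modulus x)%:E < cvg_radius a)%E].

(* Meant for open U, where it coincides with analyticity. *)
Definition holomorphic_on U f : Prop := forall x, U x -> derivable f x 1.

Definition sqrt_branch U f s : Prop :=
  holomorphic_on U s /\ (forall x, U x -> s x ^+ 2 = f x).

Definition sqrt_ratio_expansion (q p : {poly C}) a : Prop :=
  (0 < cvg_radius a)%E /\
  exists U : set C,
    [/\ U !=set0, open U, connected U & U `<=` cvg_disc a] /\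
    (forall x, U x -> p.[x] != 0) /\
    exists s : C -> C,
      sqrt_branch U (fun x => q.[x] / p.[x]) s /\
      (forall x, U x -> psum a x = s x).

End PowerSeries.

(* Coefficient of index k, with k possibly negative. *)
Definition coefz (F : nzRingType) (P : {poly F}) (k : int) : F :=
  if k is Posz m then P`_m else 0.

Definition deg (F : nzRingType) (P : {poly F}) : nat := (size P).-1.

(* Main.v *)
(* On U we have g^2 p = q; differentiating, 2 g g' p + g^2 p' = q', and eliminating q and q'
   gives R g' + Q g = 0 on U. The left-hand side is the sum of a power series with the same
   disc of convergence, so the identity theorem makes all its coefficients vanish, and these
   coefficients are exactly the left-hand sides of the recurrence.

   The set U need not contain 0. The identity theorem is therefore obtained by moving the
   centre: if the sum of a power series vanishes near x with |x| < r, then all its derivatives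
   vanish at x and the Taylor expansion at x shows that it vanishes on the ball of radius
   r - |x|; applying this along the points t^k x, with t = |x| / r, reaches 0. *)

Require Import Defs.
From HB Require Import structures.
From mathcomp Require Import all_boot all_order all_algebra.
From mathcomp Require Import all_classical all_reals all_analysis.
From mathcomp Require Import complex.
From mathcomp Require Import ring zify.

Set Implicit Arguments.
Unset Strict Implicit.
Unset Printing Implicit Defensive.

Import Order.TTheory GRing.Theory Num.Theory.
Import numFieldNormedType.Exports.

Local Open Scope classical_set_scope.
Local Open Scope ring_scope.

(** * Limits and geometric bounds for complex sequences and series *)

Section ComplexLimits.
Variable R : realType.
Local Notation C := (Cplx R).

(* Values of norms on [C] are elements of [C]; [ofR] transfers bounds between them and [R]. *)
Definition ofR (x : R) : C := x%:C%C.

Lemma ofRM x y : ofR (x * y) = ofR x * ofR y.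
Proof. exact: rmorphM. Qed.

Lemma ofRX x n : ofR (x ^+ n) = ofR x ^+ n.
Proof. exact: rmorphXn. Qed.

Lemma ofR_le x y : (ofR x <= ofR y) = (x <= y).
Proof. exact: lecR. Qed.

Lemma ofR_lt x y : (ofR x < ofR y) = (x < y).
Proof. exact: ltcR. Qed.

Lemma ofR_Re (x : C) : x \is Num.real -> ofR (complex.Re x) = x.
Proof. exact: RRe_real. Qed.

Lemma ofR_norm x : `|ofR x| = ofR `|x|.
Proof. by rewrite /ofR normc_def /= expr0n /= addr0 sqrtr_sqr. Qed.

Lemma ofR_modulus (x : C) : ofR (modulus x) = `|x|.
Proof. by rewrite ofR_Re // normr_real. Qed.

Lemma norm_Re_le (x : C) : ofR `|complex.Re x| <= `|x|.
Proof. exact: normc_ge_Re. Qed.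

Lemma norm_Im_le (x : C) : ofR `|complex.Im x| <= `|x|.
Proof.
(* Multiplication by [-i] keeps the norm and moves the imaginary part to the real part. *)
have <- : `|- ('i%C * x : C)| = `|x|.
  by rewrite normrN normrM (_ : `|'i%C : C| = 1) ?mul1r //
     [LHS]normc_def /= expr0n expr1n add0r sqrtr1.
apply: le_trans (norm_Re_le _); rewrite ofR_le.
by case: x => a b /=; rewrite mul0r mul1r sub0r opprK.
Qed.

Lemma cvg_ofR (u : nat -> R) (l : R) :
  u @ \oo --> l -> (ofR \o u) @ \oo --> ofR l.
Proof.
move=> /cvgrPdist_lt ul; apply/cvgrPdist_lt => e e0.
(* A positive element of [C] is real, so this [e] is the image of a positive real to which the
   hypothesis applies. *)
have eE := ofR_Re (gtr0_real e0); move: e0; rewrite -eE (ofR_lt 0) => /ul.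
by apply: filterS => n; rewrite /= -ofR_lt -ofR_norm /ofR rmorphB.
Qed.

Lemma cvg_expC (t : C) : 0 <= t < 1 -> (fun n => t ^+ n) @ \oo --> (0 : C).
Proof.
case/andP=> t0 t1; have := ofR_Re (ger0_real t0); move: (complex.Re t) => x xE.
have x0 : 0 <= x by rewrite -ofR_le xE.
have x1 : x < 1 by rewrite -ofR_lt xE.
rewrite -xE.
have := @cvg_ofR _ _ (@cvg_expr _ x _); rewrite ger0_norm // => /(_ x1).
by apply: cvg_trans; apply: near_eq_cvg; near=> n; rewrite /= ofRX.
Unshelve. all: by end_near. Qed.

Definition im_unit : C := 'i%C.

Lemma cvg_complex (u : nat -> C) (a b : R) :
  (fun n => complex.Re (u n)) @ \oo --> a -> (fun n => complex.Im (u n)) @ \oo --> b ->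
  u @ \oo --> ofR a + im_unit * ofR b.
Proof.
move=> /cvg_ofR ua /cvg_ofR ub.
have ib : (fun n => im_unit * ofR (complex.Im (u n))) @ \oo --> im_unit * ofR b.
  exact: cvgMl_tmp.
have s := cvgD ua ib.
apply: (cvg_trans _ (s _)); apply: near_eq_cvg; near=> n.
by rewrite [RHS]complexE.
Unshelve. all: by end_near. Qed.

Lemma Re_series (u : nat -> C) n :
  complex.Re (series u n) = series (fun k => complex.Re (u k)) n.
Proof. by rewrite /series /= (raddf_sum (@complex.Re R : Rcomplex R -> R)). Qed.

Lemma Im_series (u : nat -> C) n :
  complex.Im (series u n) = series (fun k => complex.Im (u k)) n.
Proof. by rewrite /series /= (raddf_sum (@complex.Im R : Rcomplex R -> R)). Qed.

(** The real and imaginary parts are bounded by the norm, so each of the two real series converges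
    absolutely by comparison with a geometric series. *)
Lemma cvg_series_geometric_bound (u : nat -> C) (M t : C) : 0 <= t < 1 ->
  (forall n, `|u n| <= M * t ^+ n) -> cvgn (series u).
Proof.
case/andP=> t0 t1 hu.
have M0 : 0 <= M by have := hu 0%N; rewrite mulr1; apply: le_trans; exact: normr_ge0.
set x := complex.Re t; set m := complex.Re M.
have tE : t = ofR x by rewrite ofR_Re // ger0_real.
have mE : M = ofR m by rewrite ofR_Re // ger0_real.
have x0 : 0 <= x by rewrite -ofR_le -tE.
have x1 : x < 1 by rewrite -ofR_lt -tE.
have m0 : 0 <= m by rewrite -ofR_le -mE.
have cv (v : nat -> R) : (forall n, ofR `|v n| <= `|u n|) -> cvgn (series v).
  move=> hv; apply: normed_cvg; apply: (@series_le_cvg _ _ (geometric m x)).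
  - by move=> n; exact: normr_ge0.
  - by move=> n; exact: geometric_ge0.
  - by move=> n; rewrite -ofR_le (le_trans (hv n)) // (le_trans (hu n)) // tE mE -ofRX -ofRM.
  - by apply: is_cvg_geometric_series; rewrite ger0_norm.
have /cv cr : forall n, ofR `|complex.Re (u n)| <= `|u n| by move=> n; exact: norm_Re_le.
have /cv ci : forall n, ofR `|complex.Im (u n)| <= `|u n| by move=> n; exact: norm_Im_le.
have {}cr : cvgn (fun n => complex.Re (series u n)).
  by rewrite (_ : (fun n => _) = series (fun k => complex.Re (u k))) //; apply/funext => n;
    exact: Re_series.
have {}ci : cvgn (fun n => complex.Im (series u n)).
  by rewrite (_ : (fun n => _) = series (fun k => complex.Im (u k))) //; apply/funext => n;
    exact: Im_series.
by apply/cvg_ex; eexists; exact: cvg_complex cr ci.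
Qed.

Lemma norm_cvg_le (u : nat -> C) (l B : C) :
  u @ \oo --> l -> (\forall n \near \oo, `|u n| <= B) -> `|l| <= B.
Proof.
move=> ul uB; have [n hn] := filter_ex uB.
(* The order on [C] is partial; [B] must be known to be real before [<=] can be negated into [<]. *)
have B0 : B \is Num.real by apply: ger0_real; apply: le_trans hn; exact: normr_ge0.
rewrite real_leNgt // ?normr_real //; apply/negP => Bl.
near \oo => k; have : `|u k| <= B by near: k.
have : B < `|u k| by near: k; exact: cvgr_norm_gt ul _ Bl.
by move=> /lt_le_trans h /h; rewrite ltxx.
Unshelve. all: by end_near. Qed.

Lemma series_geometric_tail (u : nat -> C) (M t l : C) N : 0 <= t < 1 ->
  (forall n, `|u n| <= M * t ^+ n) -> series u @ \oo --> l ->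
  `|l - series u N| <= M * t ^+ N / (1 - t).
Proof.
move=> /andP[t0 t1] hu ul.
have M0 : 0 <= M by have := hu 0%N; rewrite mulr1; apply: le_trans; exact: normr_ge0.
have ul' : (fun n => series u n - series u N) @ \oo --> l - series u N.
  exact: (cvgB ul (cvg_cst _)).
apply: norm_cvg_le ul' _; near=> n.
have Nn : (N <= n)%N by near: n; exists N.
rewrite sub_series_geq // (le_trans (ler_norm_sum _ _ _)) //.
apply: (@le_trans _ _ (\sum_(N <= k < n) M * t ^+ k)); first exact: ler_sum.
have tN : 1 - t != 0 by rewrite subr_eq0 gt_eqF.
(* Multiplied by [1 - t], the finite geometric sum telescopes to [t ^+ N - t ^+ n]. *)
rewrite -mulr_sumr -mulrA ler_wpM2l // ler_pdivlMr ?subr_gt0 //.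
rewrite mulr_suml (eq_bigr (fun k => - (t ^+ k.+1 - t ^+ k))); last first.
  by move=> k _; rewrite mulrBr mulr1 exprSr opprB.
by rewrite sumrN telescope_sumr // opprB gerDl oppr_le0 exprn_ge0.
Unshelve. all: by end_near. Qed.

End ComplexLimits.

(** * Domination of coefficients, and convergence of power series *)

Section PowerSeriesC.
Variable R : realType.
Local Notation C := (Cplx R).
Implicit Types (a b u : nat -> C) (r s x y : C).

(* The radius [r] is a nonnegative element of [C]; this says that the radius of convergence of
   [a] is at least [r]. *)
Definition dominated a r :=
  forall s, 0 < s < r -> exists M : C, forall n, `|a n| * s ^+ n <= M.

Definition deriv_coef a : nat -> C := fun n => n.+1%:R * a n.+1.

(** Applied to coefficients, this is multiplication by the variable with constant term [c] added;
    applied to the terms of a series, it prepends [c]. *)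
Definition shift_coef (c : C) u : nat -> C := fun n => if n is m.+1 then u m else c.

(** A bound at the midpoint [m] of [s] and [r] becomes geometric decay at [s], with ratio
    [s / m]. *)
Lemma dominated_geometric a r s : dominated a r -> 0 <= s < r ->
  exists M t, 0 <= t < 1 /\ forall n, `|a n| * s ^+ n <= M * t ^+ n.
Proof.
move=> ar /andP[s0 sr]; have [h1 h2] := midf_lt sr.
set m := (s + r) / 2 in h1 h2; have m0 := le_lt_trans s0 h1.
have [|M hM] := ar m; first by rewrite m0.
exists M, (s / m); split.
  by rewrite divr_ge0 ?(ltW m0) //= ltr_pdivrMr // mul1r.
move=> n; rewrite expr_div_n mulrA ler_pdivlMr ?exprn_gt0 //.
by rewrite mulrAC ler_wpM2r ?exprn_ge0.
Qed.

(** Each of the [n] copies of [t ^+ n] is at most one of the powers [t ^+ k] with [k < n], whose sum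
    is below that of the full geometric series. *)
Lemma natr_exp_le (t : C) n : 0 <= t < 1 -> n%:R * t ^+ n <= (1 - t)^-1.
Proof.
move=> /andP[t0 t1].
have t1' : 0 < 1 - t by rewrite subr_gt0.
apply: (@le_trans _ _ (\sum_(k < n) t ^+ k)).
  rewrite -{1}[n]card_ord -sumr_const mulr_suml.
  by apply: ler_sum => k _; rewrite mul1r ler_wiXn2l ?(ltW t1) // ltnW.
rewrite -[X in _ <= X]mul1r ler_pdivlMr // mulrC -opprB mulNr -subrX1 opprB.
by rewrite gerDl oppr_le0 exprn_ge0.
Qed.

Lemma dominatedD a b r : dominated a r -> dominated b r ->
  dominated (fun n => a n + b n) r.
Proof.
move=> ar br s sr; have [M hM] := ar _ sr; have [N hN] := br _ sr.
exists (M + N) => n; apply: le_trans (lerD (hM n) (hN n)).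
by rewrite -mulrDl ler_wpM2r ?ler_normD // exprn_ge0 // ltW; case/andP: sr.
Qed.

Lemma dominatedZ c a r : dominated a r -> dominated (fun n => c * a n) r.
Proof.
move=> ar s sr; have [M hM] := ar _ sr; exists (`|c| * M) => n.
by rewrite normrM -mulrA ler_wpM2l.
Qed.

Lemma dominated_natM a r : dominated a r -> dominated (fun n => n%:R * a n) r.
Proof.
move=> ar s /andP[s0 sr]; have [|M [t [t01 h]]] := dominated_geometric (s := s) ar.
  by rewrite ltW.
have M0 : 0 <= M.
  by have := h 0%N; rewrite !mulr1; apply: le_trans; exact: normr_ge0.
exists (M * (1 - t)^-1) => n; rewrite normrM normr_nat -mulrA.
apply: le_trans (ler_wpM2l M0 (natr_exp_le n t01)).
by rewrite [leRHS]mulrCA ler_wpM2l.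
Qed.

Lemma dominated_behead a r : dominated a r -> dominated (fun n => a n.+1) r.
Proof.
move=> ar s sr; have [M hM] := ar _ sr; have /andP[s0 _] := sr.
exists (M / s) => n; rewrite ler_pdivlMr //.
by rewrite -mulrA -exprSr.
Qed.

Lemma dominated_deriv a r : dominated a r -> dominated (deriv_coef a) r.
Proof. by move=> /dominated_natM /dominated_behead. Qed.

Lemma dominated_shift c a r : dominated a r -> dominated (shift_coef c a) r.
Proof.
move=> ar s sr; have [M hM] := ar _ sr; have /andP[s0 _] := sr.
have M0 : 0 <= M.
  by have := hM 0%N; rewrite !mulr1; apply: le_trans; exact: normr_ge0.
exists (`|c| + M * s) => -[|n] /=.
  by rewrite mulr1 lerDl mulr_ge0 // ltW.
rewrite exprSr mulrA; apply: (@le_trans _ _ (M * s)); last by rewrite lerDr.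
by rewrite ler_wpM2r // ltW.
Qed.

Lemma psumP a r x : dominated a r -> `|x| < r ->
  series (fun n => a n * x ^+ n) @ \oo --> psum a x.
Proof.
move=> ar xr; have [|M [t [t01 h]]] := dominated_geometric (s := `|x|) ar.
  by rewrite normr_ge0.
apply: (cvg_series_geometric_bound (M := M) t01) => n.
by rewrite normrM normrX.
Qed.

Lemma cvg_psumE a x l : series (fun n => a n * x ^+ n) @ \oo --> l -> psum a x = l.
Proof. by move=> h; apply: cvg_lim h; exact: norm_hausdorff. Qed.

Lemma cvg_series_shift (c : C) u l :
  series u @ \oo --> l -> series (shift_coef c u) @ \oo --> c + l.
Proof.
move=> ul; rewrite -cvg_shiftS /=.
rewrite (_ : (fun n => _) = (fun n => c + series u n)).
  exact: (cvgD (cvg_cst _) ul).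
by apply/funext => n; rewrite /series /= big_nat_recl.
Qed.

Lemma cvg_seriesD u v l l' :
  series u @ \oo --> l -> series v @ \oo --> l' ->
  series (fun n => u n + v n) @ \oo --> (l + l' : C).
Proof.
move=> ul vl; rewrite (_ : series _ = (fun n => series u n + series v n)).
  exact: (cvgD ul vl).
by apply/funext => n; rewrite /series /= big_split.
Qed.

Lemma cvg_seriesZ (c : C) u l :
  series u @ \oo --> l -> series (fun n => c * u n) @ \oo --> c * l.
Proof.
move=> ul; rewrite (_ : series _ = (fun n => c * series u n)).
  exact: (cvgMl_tmp ul).
by apply/funext => n; rewrite /series /= mulr_sumr.
Qed.

(** The second-order remainder of the power obeys a recursion in [n], and [n + n ^ 2 <= (n + 1) ^ 2]
    closes the induction. The factor [s ^+ 2] stands on the left to avoid the exponent [n - 2],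
    which truncates for small [n]. *)
Lemma taylor2_exp_le (x h s : C) n : 0 < s -> `|x| <= s -> `|x + h| <= s ->
  `|(x + h) ^+ n - x ^+ n - n%:R * h * x ^+ n.-1| * s ^+ 2 <=
  `|h| ^+ 2 * (n%:R * n%:R * s ^+ n).
Proof.
move=> s0 xs xhs; elim: n => [|n ih].
  by rewrite !expr0 subrr mul0r mul0r subr0 normr0 !mul0r mulr0.
have -> : (x + h) ^+ n.+1 - x ^+ n.+1 - n.+1%:R * h * x ^+ n.+1.-1 =
  (x + h) * ((x + h) ^+ n - x ^+ n - n%:R * h * x ^+ n.-1) + h ^+ 2 * (n%:R * x ^+ n.-1).
  case: n {ih} => [|n]; first by rewrite !expr0 !expr1 /=; ring.
  by rewrite /= !exprS -!natr1; ring.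
apply: (@le_trans _ _ (s * (`|h| ^+ 2 * (n%:R * n%:R * s ^+ n)) + `|h| ^+ 2 * (n%:R * s ^+ n.+1))).
  apply: (@le_trans _ _ ((s * `|(x + h) ^+ n - x ^+ n - n%:R * h * x ^+ n.-1| +
    `|h| ^+ 2 * (n%:R * `|x| ^+ n.-1)) * s ^+ 2)).
    rewrite ler_wpM2r ?exprn_ge0 ?(ltW s0) // (le_trans (ler_normD _ _)) //.
    by rewrite !normrM !normrX normr_nat lerD2r ler_wpM2r.
  rewrite mulrDl -mulrA lerD // ?ler_wpM2l ?(ltW s0) // -mulrA ler_wpM2l ?exprn_ge0 //.
  case: n {ih} => [|n]; first by rewrite !mul0r.
  have -> : s ^+ n.+2 = s ^+ n * s ^+ 2 by rewrite -exprD addn2.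
  rewrite -mulrA ler_wpM2l // ler_wpM2r ?exprn_ge0 ?(ltW s0) //.
  by rewrite lerXn2r // nnegrE (ltW s0).
rewrite mulrCA -mulrDr ler_wpM2l ?exprn_ge0 //.
rewrite mulrCA -exprS -mulrDl ler_wpM2r ?exprn_ge0 ?(ltW s0) //.
by rewrite -!natrM -natrD ler_nat addnC -mulnS leq_mul.
Qed.

End PowerSeriesC.

(** * Termwise complex differentiation of power series *)

Section Derivative.
Variable R : realType.
Local Notation C := (Cplx R).
Implicit Types (a b u : nat -> C) (r s x y : C).

Lemma psum_taylor1_le a r x : dominated a r -> `|x| < r ->
  exists K d, [/\ 0 <= K, 0 < d & forall h, `|h| < d ->
    `|psum a (x + h) - psum a x - h * psum (deriv_coef a) x| <= K * `|h| ^+ 2].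
Proof.
move=> ar xr; have [xs sr] := midf_lt xr.
set s := (`|x| + r) / 2 in xs sr; have s0 : 0 < s := le_lt_trans (normr_ge0 _) xs.
(* The two factors [n] are those of the bound in [taylor2_exp_le]; domination absorbs them. *)
have [|M [t [t01 hM]]] := dominated_geometric (s := s) (dominated_natM (dominated_natM ar)).
  by rewrite (ltW s0).
have M0 : 0 <= M.
  by have := hM 0%N; rewrite !mulr1; apply: le_trans; exact: normr_ge0.
have t1 : 0 < 1 - t by rewrite subr_gt0; case/andP: t01.
exists (M / s ^+ 2 / (1 - t)), (s - `|x|); split.
- by rewrite !mulr_ge0 // invr_ge0 ?exprn_ge0 // ltW.
- by rewrite subr_gt0.
move=> h hd; have xhs : `|x + h| <= s.
  by rewrite (le_trans (ler_normD _ _)) // addrC -lerBrDr ltW.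
have c1 := psumP ar (le_lt_trans xhs sr).
have c2 := psumP ar xr.
(* A zero term is prepended so that the term of index [n] is [n * a n * x ^+ n.-1], and the three
   series can be combined termwise. *)
have c3 := cvg_series_shift (c := 0) (psumP (dominated_deriv ar) xr).
have c23 := cvg_seriesD (cvg_seriesZ (c := -1) c2) (cvg_seriesZ (c := - h) c3).
have c := cvg_seriesD c1 c23.
have -> : psum a (x + h) - psum a x - h * psum (deriv_coef a) x =
   psum a (x + h) + (-1 * psum a x + - h * (0 + psum (deriv_coef a) x)).
  by rewrite mulN1r add0r mulNr addrA.
(* The tail from index 0 is the whole sum. *)
have := @series_geometric_tail _ _ (`|h| ^+ 2 * (M / s ^+ 2)) t _ 0 t01 _ c.
rewrite [series _ _]big_geq // subr0 expr0 mulr1.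
rewrite (_ : M / s ^+ 2 / (1 - t) * `|h| ^+ 2 = `|h| ^+ 2 * (M / s ^+ 2) / (1 - t)); last by ring.
apply => n.
have -> : a n * (x + h) ^+ n + (-1 * (a n * x ^+ n) +
    - h * shift_coef 0 (fun n => deriv_coef a n * x ^+ n) n) =
    a n * ((x + h) ^+ n - x ^+ n - n%:R * h * x ^+ n.-1).
  by case: n => [|n]; rewrite /= /deriv_coef; ring.
rewrite normrM -[leRHS]mulrA (mulrAC M) [leRHS]mulrA ler_pdivlMr ?exprn_gt0 //.
rewrite -[leLHS]mulrA (le_trans (ler_wpM2l (normr_ge0 _) (taylor2_exp_le n s0 (ltW xs) xhs))) //.
rewrite mulrCA ler_wpM2l ?exprn_ge0 // (le_trans _ (hM n)) //.
by rewrite !normrM normr_nat mulrCA !mulrA.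
Qed.

Lemma is_derive_psum a r x : dominated a r -> `|x| < r ->
  is_derive x 1 (psum a) (psum (deriv_coef a) x).
Proof.
move=> ar xr; have [K [d [K0 d0 hK]]] := psum_taylor1_le ar xr.
have cv : (fun h : C => h^-1 *: ((psum a \o shift x) (h *: 1) - psum a x)) @ 0^' -->
    psum (deriv_coef a) x.
  apply/cvgrPdist_le => e e0; near=> h.
  have h0 : h != 0 by near: h; exact: nbhs_dnbhs_neq.
  have hd : `|h| < d by near: h; exact: dnbhs0_lt.
  (* [K] may be zero, hence the denominator [K + 1]. *)
  have he : `|h| < e / (K + 1).
    by near: h; apply: dnbhs0_lt; rewrite divr_gt0 // ltr_wpDl.
  have h0' : 0 < `|h| by rewrite normr_gt0.
  rewrite -(ler_pM2l h0') -normrM.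
  rewrite (_ : h * _ = - (psum a (x + h) - psum a x - h * psum (deriv_coef a) x)).
    rewrite normrN (le_trans (hK _ hd)) // expr2 mulrA mulrC ler_wpM2l //.
    rewrite (@le_trans _ _ ((K + 1) * `|h|)) ?ler_wpM2r ?lerDl //.
    by rewrite mulrC -ler_pdivlMr ?ltW // ltr_wpDl.
  rewrite /shift /= mulrBr [h *: 1]mulr1 [h^-1 *: _]/(_ * _) mulrA divff // mul1r.
  by rewrite [h + x]addrC [RHS]opprB.
by apply: DeriveDef; [apply/cvg_ex; eexists; exact: cv|apply: cvg_lim cv; exact: norm_hausdorff].
Unshelve. all: by end_near. Qed.

End Derivative.

(** * The identity theorem for power series, by moving the centre *)

Section IdentityTheorem.
Variable R : realType.
Local Notation C := (Cplx R).
Implicit Types (a b u : nat -> C) (r s x y : C).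

Lemma near_norm_lt (x y : C) (e : C) : `|y - x| < e -> \forall z \near y, `|z - x| < e.
Proof.
move=> yxe; have c : (fun z : C => z - x) @ y --> y - x.
  exact: (cvgB cvg_id (cvg_cst _)).
exact: cvgr_norm_lt c _ yxe.
Qed.

Lemma cvg_iter_deriv a r x k : dominated a r -> `|x| < r ->
  series (fun n => (n ^_ k)%:R * a n * x ^+ (n - k)) @ \oo -->
  psum (iter k (@deriv_coef R) a) x.
Proof.
move=> + xr; elim: k a => [|k ih] a ar.
  rewrite (_ : (fun n => _) = (fun n => a n * x ^+ n)); first exact: psumP ar xr.
  by apply/funext => n; rewrite ffactn0 mul1r subn0.
rewrite iterSr -[psum _ x]add0r.
rewrite (_ : (fun n => _) = shift_coef 0
    (fun n => (n ^_ k)%:R * deriv_coef a n * x ^+ (n - k))).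
  exact: cvg_series_shift (ih _ (dominated_deriv ar)).
apply/funext => -[|n] /=; first by rewrite ffact0n !mul0r.
by rewrite ffactSS natrM subSS /deriv_coef mulrCA !mulrA.
Qed.

Lemma near_deriv_eq0 a r x : dominated a r -> `|x| < r ->
  (\forall y \near x, psum a y = 0) -> \forall y \near x, psum (deriv_coef a) y = 0.
Proof.
move=> ar xr /nbhs_interior a0; have := @near_norm_lt 0 x r.
rewrite subr0 => /(_ xr) rx; near=> y.
have yr : `|y| < r by rewrite -[y]subr0; near: y.
have ay : \forall z \near y, psum a z = cst 0 z by near: y.
by rewrite -(derive_val (is_derive := is_derive_psum ar yr)) (near_eq_derive _ ay) derive_cst.
Unshelve. all: by end_near. Qed.

Lemma iter_deriv_eq0 a r x k : dominated a r -> `|x| < r ->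
  (\forall y \near x, psum a y = 0) -> psum (iter k (@deriv_coef R) a) x = 0.
Proof.
move=> + xr; elim: k a => [|k ih] a ar a0; first exact: nbhs_singleton a0.
rewrite iterSr; apply: ih; first exact: dominated_deriv.
exact: near_deriv_eq0 ar xr a0.
Qed.

(** The binomial coefficients vanish for [k > n]; this frees the number of summands from [n], as the
    exchange of summations in [psum_eq0_ball] requires. *)
Lemma exprDn_wide (x y : C) n N : (n < N)%N ->
  \sum_(k < N) x ^+ (n - k) * y ^+ k *+ 'C(n, k) = (x + y) ^+ n.
Proof.
move=> nN; rewrite exprDn -(big_mkord xpredT (fun k => x ^+ (n - k) * y ^+ k *+ 'C(n, k))).
rewrite (big_cat_nat _ nN) //= [X in _ + X]big_nat_cond [X in _ + X]big1 => [|k].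
  by rewrite addr0 big_mkord.
by rewrite andbT => /andP[nk _]; rewrite bin_small // mulr0n.
Qed.

Lemma binomial_partial_sum_le (x y : C) n N : 0 <= x -> 0 <= y ->
  \sum_(k < N) x ^+ (n - k) * y ^+ k *+ 'C(n, k) <= (x + y) ^+ n.
Proof.
move=> x0 y0; rewrite -(@exprDn_wide x y n (N + n.+1)) ?ltn_addl //.
rewrite big_split_ord /= lerDl; apply: sumr_ge0 => k _.
by rewrite mulrn_wge0 // mulr_ge0 // exprn_ge0.
Qed.

Lemma psum_eq0_ball a r x y : dominated a r -> `|x| + `|y| < r ->
  (\forall z \near x, psum a z = 0) -> psum a (x + y) = 0.
Proof.
move=> ar xyr a0.
have xr : `|x| < r by apply: le_lt_trans xyr; rewrite lerDl.
have [|M [t [t01 hM]]] := dominated_geometric (s := `|x| + `|y|) ar.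
  by rewrite addr_ge0.
(* [T k] sums to [y ^+ k / k`!] times the k-th derivative at [x], hence to 0, while
   [\sum_(k < N) T k n] is the n-th term at [x + y] as soon as [n < N]. So minus the N-th partial
   sum at [x + y] is a tail of a series that is geometrically bounded uniformly in [N]. *)
pose T k n := a n * (x ^+ (n - k) * y ^+ k *+ 'C(n, k)).
have cT k : series (T k) @ \oo --> (0 : C).
  have := @iter_deriv_eq0 a r x k ar xr a0.
  have /(cvg_seriesZ (c := y ^+ k / k`!%:R)) := cvg_iter_deriv (k := k) ar xr.
  move=> + h0; rewrite h0 mulr0 => c.
  rewrite (_ : T k = (fun n => y ^+ k / k`!%:R * ((n ^_ k)%:R * a n * x ^+ (n - k)))) //.
  apply/funext => n; have k0 : k`!%:R != 0 :> C by rewrite pnatr_eq0 -lt0n fact_gt0.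
  rewrite -bin_ffact natrM /T -mulr_natr.
  move: (k`!%:R) k0 ('C(n, k)%:R) (a n) (x ^+ (n - k)) (y ^+ k) => f f0 b c1 c2 c3.
  by field.
have cw N : series (fun n => \sum_(k < N) T k n) @ \oo --> (0 : C).
  elim: N => [|N ih].
    rewrite (_ : series _ = fun=> 0); first exact: cvg_cst.
    by apply/funext => n; rewrite /series /= big1 // => i _; rewrite big_ord0.
  rewrite (_ : (fun n => _) = (fun n => \sum_(k < N) T k n + T N n)).
    by have := cvg_seriesD ih (cT N); rewrite addr0.
  by apply/funext => n; rewrite big_ord_recr.
have wM N n : `|\sum_(k < N) T k n| <= M * t ^+ n.
  apply: le_trans (hM n); rewrite -mulr_sumr normrM ler_wpM2l //.
  apply: le_trans (binomial_partial_sum_le n N (normr_ge0 x) (normr_ge0 y)).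
  apply: le_trans (ler_norm_sum _ _ _) _; apply: ler_sum => k _.
  by rewrite normrMn normrM !normrX.
have St N : `|series (fun n => a n * (x + y) ^+ n) N| <= M / (1 - t) * t ^+ N.
  have := series_geometric_tail N t01 (wM N) (cw N).
  rewrite sub0r normrN mulrAC; apply: le_trans.
  rewrite le_eqVlt; apply/orP; left; apply/eqP; congr `|_|.
  apply: eq_big_nat => n /andP[_ nN].
  by rewrite -mulr_sumr exprDn_wide.
apply: cvg_psumE; apply/cvgr0Pnorm_le => e e0.
have : (fun N => M / (1 - t) * t ^+ N) @ \oo --> (0 : C).
  by have := cvgMl_tmp (a := M / (1 - t)) (cvg_expC t01); rewrite mulr0; apply.
move=> /cvgr0Pnorm_le /(_ _ e0); apply: filterS => N; apply: le_trans.
by rewrite [leRHS]ger0_norm ?St // (le_trans _ (St N)).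
Qed.

Lemma near_psum_eq0_step a r x z : dominated a r -> `|x| + `|z - x| < r ->
  (\forall y \near x, psum a y = 0) -> \forall y \near z, psum a y = 0.
Proof.
move=> ar xzr a0; have zx : `|z - x| < r - `|x| by rewrite ltrBrDl.
have := near_norm_lt zx; apply: filterS => y.
rewrite ltrBrDl => xyr; rewrite -(subrKC x y).
exact: psum_eq0_ball ar xyr a0.
Qed.

Lemma near0_psum_eq0 a r x : dominated a r -> `|x| < r ->
  (\forall y \near x, psum a y = 0) -> \forall y \near 0, psum a y = 0.
Proof.
move=> ar xr a0; have r0 : 0 < r by exact: le_lt_trans xr.
pose t := `|x| / r; have t01 : 0 <= t < 1.
  by rewrite divr_ge0 ?(ltW r0) //= ltr_pdivrMr ?mul1r.
have /andP[t0 t1] := t01.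
have tx k : `|t ^+ k * x| <= `|x|.
  by rewrite normrM normrX (ger0_norm t0) ler_piMl // exprn_ile1 // ltW.
have chain k : \forall y \near t ^+ k * x, psum a y = 0.
  elim: k => [|k ih]; first by rewrite mul1r.
  apply: near_psum_eq0_step ar _ ih.
  (* The step from [t ^+ k * x] to the next point has length at most [(1 - t) * |x|]. Since
     [1 - t = (r - |x|) / r] and [|x| < r], this is less than [r - |x|]. *)
  apply: (@le_lt_trans _ _ (`|x| + (1 - t) * `|x|)).
    have -> : t ^+ k.+1 * x - t ^+ k * x = (t - 1) * (t ^+ k * x).
      by rewrite mulrBl mul1r mulrA -exprS.
    have t1' : 0 <= 1 - t by rewrite subr_ge0 ltW.
    rewrite lerD ?tx // normrM distrC (ger0_norm t1'); exact: ler_wpM2l (tx k).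
  rewrite -ltrBrDl (_ : 1 - t = (r - `|x|) / r).
    by rewrite mulrAC ltr_pdivrMr // ltr_pM2l // subr_gt0.
  by rewrite mulrBl divff // gt_eqF.
have : (fun k => t ^+ k * x) @ \oo --> (0 : C).
  by have := cvgMr_tmp (b := x) (cvg_expC t01); rewrite mul0r; apply.
(* Once a point of the chain has norm below [r / 2], its distance to 0 plus its norm is below [r],
   so one last step reaches 0. *)
have [r20 _] := midf_lt r0; rewrite add0r in r20.
move=> /cvgr0_norm_lt /(_ _ r20) /filter_ex[k kr].
apply: near_psum_eq0_step ar _ (chain k).
by rewrite sub0r normrN (splitr r) ltrD.
Qed.

Lemma psum0 a r : dominated a r -> 0 < r -> psum a 0 = a 0%N.
Proof.
move=> ar r0; apply: cvg_psumE.
have z : series (fun=> 0 : C) @ \oo --> (0 : C).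
  rewrite (_ : series _ = fun=> 0); first exact: cvg_cst.
  by apply/funext => n; rewrite /series /= big1.
rewrite (_ : (fun n => _) = shift_coef (a 0%N) (fun=> 0)).
  by have := cvg_series_shift (c := a 0%N) z; rewrite addr0.
by apply/funext => -[|n] /=; rewrite ?mulr1 // expr0n mulr0.
Qed.

(** The constant coefficient is the value at 0. The induction passes to the derivative, whose
    coefficient [n] is [a n.+1] times a nonzero integer. *)
Lemma coef_eq0_near0 a r n : dominated a r -> 0 < r ->
  (\forall y \near 0, psum a y = 0) -> a n = 0.
Proof.
move=> + r0; elim: n a => [|n ih] a ar a0.
  by rewrite -(psum0 ar r0) (nbhs_singleton a0).
have n0 : `|0 : C| < r by rewrite normr0.
have /eqP := ih _ (dominated_deriv ar) (near_deriv_eq0 ar n0 a0).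
by rewrite mulf_eq0 pnatr_eq0 => /eqP.
Qed.

Lemma psum_identity a r x : dominated a r -> `|x| < r ->
  (\forall y \near x, psum a y = 0) -> forall n, a n = 0.
Proof.
move=> ar xr a0 n; apply: (coef_eq0_near0 n ar (le_lt_trans (normr_ge0 x) xr)).
exact: near0_psum_eq0 ar xr a0.
Qed.

End IdentityTheorem.

(** * Products of a polynomial and a power series *)

Section PolynomialMultiple.
Variable R : realType.
Local Notation C := (Cplx R).
Implicit Types (a b : nat -> C) (r x : C) (P : {poly C}).

Definition mulps P a : nat -> C := fun n => \sum_(j < n.+1) P`_j * a (n - j)%N.

(** This is the Horner step: it lets facts about [mulps] be proved by induction on the polynomial
    from scaling, shift and addition alone. *)
Lemma mulps_cons P (c : C) a :
  mulps (P * 'X + c%:P) a = (fun n => c * a n + shift_coef 0 (mulps P a) n).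
Proof.
apply/funext => n; rewrite /mulps big_ord_recl subn0 coefD coefMX coefC add0r.
congr (_ + _); case: n => [|n] /=; first by rewrite big_ord0.
by apply: eq_bigr => j _; rewrite coefD coefMX coefC addr0.
Qed.

Lemma dominated_mulps P a r : dominated a r -> dominated (mulps P a) r.
Proof.
move=> ar; elim/poly_ind: P => [|P c ih].
  move=> s _; exists 0 => n; rewrite /mulps big1 ?normr0 ?mul0r // => i _.
  by rewrite coef0 mul0r.
by rewrite mulps_cons; apply: dominatedD (dominatedZ c ar) (dominated_shift 0 ih).
Qed.

Lemma psumD a b r x : dominated a r -> dominated b r -> `|x| < r ->
  psum (fun n => a n + b n) x = psum a x + psum b x.
Proof.
move=> ar br xr; apply: cvg_psumE.
rewrite (_ : (fun n => _) = (fun n => a n * x ^+ n + b n * x ^+ n)).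
  exact: cvg_seriesD (psumP ar xr) (psumP br xr).
by apply/funext => n; rewrite mulrDl.
Qed.

Lemma psumZ c a r x : dominated a r -> `|x| < r ->
  psum (fun n => c * a n) x = c * psum a x.
Proof.
move=> ar xr; apply: cvg_psumE.
rewrite (_ : (fun n => _) = (fun n => c * (a n * x ^+ n))).
  exact: cvg_seriesZ (psumP ar xr).
by apply/funext => n; rewrite mulrA.
Qed.

Lemma psum_shift a r x : dominated a r -> `|x| < r ->
  psum (shift_coef 0 a) x = x * psum a x.
Proof.
move=> ar xr; apply: cvg_psumE.
rewrite (_ : (fun n => _) = shift_coef 0 (fun n => x * (a n * x ^+ n))).
  have := cvg_series_shift (c := 0) (cvg_seriesZ (c := x) (psumP ar xr)).
  by rewrite add0r.
by apply/funext => -[|n]; rewrite /= ?mul0r // exprS mulrCA.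
Qed.

Lemma psum_mulps P a r x : dominated a r -> `|x| < r ->
  psum (mulps P a) x = P.[x] * psum a x.
Proof.
move=> ar xr; elim/poly_ind: P => [|P c ih].
  have -> : mulps 0 a = (fun n => 0 * a n).
    by apply/funext => n; rewrite mul0r /mulps big1 // => i _; rewrite coef0 mul0r.
  by rewrite (psumZ _ ar xr) horner0.
have Pr := dominated_mulps P ar.
rewrite mulps_cons (psumD (dominatedZ c ar) (dominated_shift 0 Pr) xr).
rewrite (psumZ _ ar xr) (psum_shift Pr xr) ih hornerMXaddC mulrDl addrC.
by rewrite mulrA [x * _]mulrC.
Qed.

Lemma is_derive_horner P (x : C) : is_derive x 1 (horner P) P^`().[x].
Proof.
elim/poly_ind: P => [|P c ih].
  rewrite (_ : horner 0 = cst 0); last by apply/funext => y; rewrite horner0.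
  by rewrite deriv0 horner0; exact: is_derive_cst.
rewrite (_ : horner _ = horner P * id + cst c); last first.
  by apply/funext => y; rewrite hornerMXaddC.
have d := is_deriveD (is_deriveM ih (is_derive_id x (1 : C))) (is_derive_cst c x (1 : C)).
apply: (is_derive_eq d).
rewrite derivMXaddC hornerD hornerMX addr0 [P.[x] *: 1]mulr1; congr (_ + _).
exact: mulrC.
Qed.

End PolynomialMultiple.

(** * The differential equation and the recurrence *)

Lemma disc_dominated (R : realType) (a : nat -> Cplx R) (x : Cplx R) :
  cvg_disc a x -> exists2 r, dominated a r & `|x| < r.
Proof.
(* The supremum yields a point [y] of convergence with [|x| < |y|]; the terms at [y] tend to 0,
   hence are bounded, so [|y|] serves as [r]. *)
move=> /ereal_sup_gt[_ [y /= cy <-]]; rewrite lte_fin => xy.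
exists `|y|; last by rewrite -!ofR_modulus ofR_lt.
have c0 := @cvg_series_cvg_0 _ _ (fun n => a n * y ^+ n) cy.
have [M _ hM] := pinfty_ex_gt0 (cvg_seq_bounded (cvgP _ c0)).
move=> s /andP[s0 sy]; exists M => n.
have /= := hM n I; rewrite normrM normrX; apply: le_trans.
by apply: ler_wpM2l => //; rewrite lerXn2r // ?nnegrE ltW.
Qed.

(** The primed letters are arbitrary ring elements standing for derivatives; substituting for [q]
    and [q'] leaves a polynomial identity. *)
Lemma sqrt_ratio_ode (F : comNzRingType) (f f' p p' q q' : F) :
  f * f * p = q -> (f * f' + f * f') * p + f * f * p' = q' ->
  2%:R * (q * p) * f' + (q * p' - q' * p) * f = 0.
Proof. by move=> <- <-; ring. Qed.

Lemma sum_nat_widen (V : nmodType) (F : nat -> V) m n : (m <= n)%N ->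
  (forall j, (m <= j)%N -> F j = 0) -> \sum_(0 <= j < m) F j = \sum_(0 <= j < n) F j.
Proof.
move=> mn F0; rewrite (big_cat_nat _ mn) //= [X in _ + X]big_nat_cond.
by rewrite [X in _ + X]big1 ?addr0 // => j /andP[/andP[/F0]].
Qed.

(** Each product has one differentiated factor, of smaller size. Consequently the indices below
    [deg Rp] exhaust the coefficients of [Qp] in the recurrence. *)
Lemma size_wronskian (F : idomainType) (p q : {poly F}) : p != 0 -> q != 0 ->
  (size (q * p^`() - q^`() * p)%R <= (size (q * p)%R).-1)%N.
Proof.
move=> p0 q0; rewrite size_mul //.
have sp := lt_size_deriv p0; have sq := lt_size_deriv q0.
apply: leq_trans (size_polyD _ _) _; rewrite size_polyN geq_max.
have le m n k : (n < k -> (m + n).-1 <= (m + k).-1.-1)%N by lia.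
apply/andP; split; apply: leq_trans (size_polyMleq _ _) _; first exact: le.
by rewrite addnC [(size q + _)%N]addnC le.
Qed.

Theorem theorem3 (R : realType) (p q : {poly Cplx R}) (g : nat -> Cplx R)
    (p_neq0 : p != 0) (q_neq0 : q != 0)
    (g_expansion : sqrt_ratio_expansion q p g) :
  let Rp : {poly Cplx R} := 2%:R *: (q * p) in
  let Qp : {poly Cplx R} := q * p^`() - q^`() * p in
  (forall x : Cplx R, cvg_disc g x ->
     derivable (psum g) x 1 /\
     Rp.[x] * derive1 (psum g) x + Qp.[x] * psum g x = 0) /\
  (forall n : nat, (deg Rp < n)%N ->
     \sum_(0 <= j < (deg Rp).+1)
       ((n - j)%:R * coefz Rp j%:Z + coefz Qp (j%:Z - 1)) * g (n - j)%N = 0).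
Proof.
move=> Rp Qp.
have derive1_psum x r (gr : dominated g r) (xr : `|x| < r) :
    derive1 (psum g) x = psum (deriv_coef g) x.
  by rewrite derive1E; exact: (derive_val (is_derive := is_derive_psum gr xr)).
(* These are the coefficients of the left-hand side of the differential equation. *)
pose h n := mulps Rp (deriv_coef g) n + mulps Qp g n.
have psum_h x r (gr : dominated g r) (xr : `|x| < r) :
    psum h x = Rp.[x] * psum (deriv_coef g) x + Qp.[x] * psum g x.
  have Dr := dominated_deriv gr.
  rewrite (psumD (dominated_mulps Rp Dr) (dominated_mulps Qp gr) xr).
  by rewrite (psum_mulps _ Dr xr) (psum_mulps _ gr xr).
have h0 n : h n = 0.
  have [_ [U [[[x0 Ux0] oU _ Udisc] [pU [s [[_ s2] gs]]]]]] := g_expansion.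
  have [r gr x0r] := disc_dominated (Udisc _ Ux0).
  have hr : dominated h r.
    exact: dominatedD (dominated_mulps _ (dominated_deriv gr)) (dominated_mulps _ gr).
  apply: (psum_identity hr x0r).
  have nU : \forall x \near x0, U x by apply: open_nbhs_nbhs.
  apply: filterS nU => x Ux {r gr x0r hr}.
  (* A radius is chosen anew for [x], since the one found for [x0] need not exceed [|x|]. *)
  have [r gr xr] := disc_dominated (Udisc _ Ux).
  have algU y : U y -> psum g y * psum g y * p.[y] = q.[y].
    by move=> Uy; rewrite (gs _ Uy) -expr2 (s2 _ Uy) divfK // pU.
  have near_alg : \forall y \near x, ((psum g * psum g) * horner p) y = q.[y].
    by apply: filterS (open_nbhs_nbhs (conj oU Ux)) => y /algU.
  have dg := is_derive_psum gr xr.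
  (* The relation [g ^ 2 * p = q] holds on a neighbourhood of [x], so both sides have the same
     derivative there. *)
  have dl := near_eq_is_derive near_alg (is_deriveM (is_deriveM dg dg) (is_derive_horner p x)).
  have e := derive_val (is_derive := dl).
  rewrite (derive_val (is_derive := is_derive_horner q x)) in e.
  rewrite (psum_h _ _ gr xr) /Rp /Qp hornerZ hornerD hornerN !hornerM.
  apply: sqrt_ratio_ode (algU _ Ux) _; rewrite e [LHS]addrC.
  by congr (_ + _); exact: mulrC.
split=> [x gx|n dn].
  have [r gr xr] := disc_dominated gx; split.
    exact: (ex_derive (is_derive := is_derive_psum gr xr)).
  rewrite (derive1_psum _ _ gr xr) -(psum_h _ _ gr xr); apply: cvg_psumE.
  rewrite (_ : series _ = fun=> 0); first exact: cvg_cst.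
  by apply/funext => n; rewrite /series /= big1 // => i _; rewrite h0 mul0r.
(* Differentiation lowers the index by one, so the recurrence at [m.+1] is the coefficient [h m]. *)
case: n dn => // m dm; rewrite -[RHS](h0 m).
transitivity (\sum_(0 <= j < (deg Rp).+1) (m.+1 - j)%:R * Rp`_j * g (m.+1 - j)%N +
    \sum_(0 <= j < (deg Rp).+1) coefz Qp (j%:Z - 1) * g (m.+1 - j)%N).
  by rewrite -big_split; apply: eq_bigr => j _; rewrite mulrDl.
congr (_ + _).
  (* Here [deg Rp <= m], and the added coefficients of [Rp] are zero. *)
  rewrite (@sum_nat_widen _ _ _ m.+1) // => [|j dj]; last first.
    by rewrite nth_default ?mulr0 ?mul0r // (leq_trans _ dj) // leqSpred.
  rewrite big_mkord; apply: eq_bigr => j _.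
  have jm : (j <= m)%N by rewrite -ltnS.
  by rewrite /deriv_coef (subSn jm) mulrA [_ * Rp`_j]mulrC.
(* The term [j = 0] carries the coefficient of [Qp] at index -1, which [coefz] sets to 0. *)
rewrite big_nat_recl // mul0r add0r.
rewrite (eq_bigr (fun j => Qp`_j * g (m - j)%N)) => [|j _]; last first.
  by rewrite subSS intS addrC addKr.
rewrite (@sum_nat_widen _ _ _ m.+1) ?big_mkord // 1?ltnW // => j dj.
rewrite nth_default ?mul0r // (leq_trans _ dj) //.
by rewrite /deg size_scale ?pnatr_eq0 // size_wronskian.
Qed.
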